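(* Let $A(\cdot):(a,b)\to\mathbb{R}^{n\times n}$ be a continuous matrix function, and suppose that the system $\dot x(t)=A(t)x(t)$ is a cyclic variation diminishing differential system (CVDDS) on $(a,b)$. If $x(t)$ is a solution of this system on $(a,b)$ that is not the trivial solution $x(t)\equiv 0$, then: (1) $s_c^-(x(t))$ and $s_c^+(x(t))$ are non-increasing functions of time on $(a,b)$; (2) $x(t)\in V_c$ for all $t\in(a,b)$, except perhaps for up to $\lfloor n/2\rfloor$ discrete values of $t$; (3) there exists a time $T\in(a,b)$ such that $$s_c^-(x(\tau))=s_c^+(x(\tau))\quad\text{for all }\tau\in[T,b),$$ and for all such $\tau$ no two consecutive entries (in the cyclic order) of $x$ satisfy $x_i(\tau)=x_{i+1}(\tau)=0$.
   Context: In the cyclic order, the entry following $x_n$ is $x_1$ (i.e. $x_{n+1}:=x_1$). Sign variations. For a vector $y\in\mathbb{R}^m$ with no zero entries, $\sigma(y)$ is the number of indices $k\in\{1,\dots,m-1\}$ with $y_ky_{k+1}<0$. For any $y\in\mathbb{R}^m$: $s^-(y):=\sigma(\bar y)$, where $\bar y$ is obtained from $y$ by deleting all zero entries (and $s^-(0):=0$); $s^+(y):=\max_{z\in P(y)}\sigma(z)$, where $P(y)$ is the set of vectors obtained from $y$ by replacing each zero entry by either $1$ or $-1$. Cyclic sign variations. For $y\in\mathbb{R}^n$, $$s_c^-(y):=\max_{i\in\{1,\dots,n\}} s^-\big([y_i,\dots,y_n,y_1,\dots,y_i]'\big),\qquad s_c^+(y):=\max_{i\in\{1,\dots,n\}}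 s^+\big([y_i,\dots,y_n,y_1,\dots,y_i]'\big),$$ where each bracketed vector has $n+1$ entries (it goes once around the ring, beginning and ending with $y_i$), and where in the definition of $s_c^+$, if $y_i=0$, then both copies of $y_i$ (the first and the last entry) are replaced by the same value, either $1$ or $-1$. Let $V_c:=\{x\in\mathbb{R}^n: s_c^-(x)=s_c^+(x)\}$. SCVDP. A matrix $B\in\mathbb{R}^{n\times n}$ satisfies the strong cyclic variation diminishing property (SCVDP) if $s_c^+(Bx)\le s_c^-(x)$ for all $x\in\mathbb{R}^n\setminus\{0\}$. CVDDS. Let $\Phi(t,t_0)$ denote the transition matrix, i.e. the solution of $\frac{d}{dt}\Phi(t,t_0)=A(t)\Phi(t,t_0)$, $\Phi(t_0,t_0)=I$. The system $\dot x(t)=A(t)x(t)$ is called a cyclic variation diminishing differential system (CVDDS) on $(a,b)$ if $\Phi(t,t_0)$ satisfies the SCVDP for every pair $(t_0,t)$ with $a<t_0<t<b$. *)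

(* Defs.v *)
From HB Require Import structures.
From mathcomp Require Import all_boot all_order all_algebra.
From mathcomp Require Import all_classical all_reals all_analysis.

Set Implicit Arguments.
Unset Strict Implicit.
Unset Printing Implicit Defensive.

Import Order.TTheory GRing.Theory Num.Theory.
Import numFieldNormedType.Exports.

Local Open Scope classical_set_scope.
Local Open Scope ring_scope.

(* Vectors of arbitrary length are sequences; sigma is meant for sequences
   without zero entries. *)
Definition sigma (R : realType) (y : seq R) : nat :=
  count (fun k => y`_k * y`_k.+1 < 0) (iota 0 (size y).-1).

Definition s_minus (R : realType) (y : seq R) : nat :=
  sigma [seq r <- y | r != 0].

(* The set P(y), enumerated with repetitions: the k-th entry, when it is zero,
   is replaced by 1 or -1 according to the k-th bit of e. *)
Definition zero_fillings (R : realType) (y : seq R) : seq (seq R) :=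
  [seq [seq if p.2 == 0 then (-1) ^+ (p.1 : bool) else p.2 | p <- zip e y]
     | e : (size y).-tuple bool].

(* [y_i, ..., y_n, y_1, ..., y_i], of size n + 1. *)
Definition ring_from (R : realType) (n : nat) (y : 'cV[R]_n) (i : 'I_n) :
    seq R :=
  rcons (rot i [seq y j 0 | j <- enum 'I_n]) (y i 0).

Definition sc_minus (R : realType) (n : nat) (y : 'cV[R]_n) : nat :=
  \max_(i < n) s_minus (ring_from y i).

(* The inner maximum is s^+ of the (n + 1)-vector ring_from y i, except that
   the two copies of y_i are required to receive the same value; the filter
   head = last is automatically satisfied when y_i <> 0. *)
Definition sc_plus (R : realType) (n : nat) (y : 'cV[R]_n) : nat :=
  \max_(i < n)
    \max_(z <- zero_fillings (ring_from y i) | head 0%R z == last 0%R z)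
      sigma z.

Definition Vc (R : realType) (n : nat) : set 'cV[R]_n :=
  [set x | sc_minus x = sc_plus x].

Definition SCVDP (R : realType) (n : nat) (B : 'M[R]_n) : Prop :=
  forall x : 'cV[R]_n, x != 0 -> (sc_plus (B *m x) <= sc_minus x)%N.

(* The interval (a, b); its endpoints may be infinite. *)
Definition oint (R : realType) (a b : \bar R) : set R :=
  [set t | (a < t%:E < b)%E].

(* X' = A X on (a, b), for a vector (p = 1) or a matrix function X. *)
Definition solves (R : realType) (n p : nat) (a b : \bar R)
    (A : R -> 'M[R]_n) (X : R -> 'M[R]_(n, p)) : Prop :=
  forall t : R, oint a b t -> is_derive t (1 : R) X (A t *m X t).

Definition transition_matrix (R : realType) (n : nat) (a b : \bar R)
    (A : R -> 'M[R]_n) (Phi : R -> R -> 'M[R]_n) : Prop :=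
  forall t0 : R, oint a b t0 ->
    solves a b A (Phi^~ t0) /\ Phi t0 t0 = 1%:M.

(* For continuous A the transition matrix exists and is unique on (a, b), so
   the existential quantifier merely names it. *)
Definition CVDDS (R : realType) (n : nat) (a b : \bar R)
    (A : R -> 'M[R]_n) : Prop :=
  exists Phi : R -> R -> 'M[R]_n,
    transition_matrix a b A Phi /\
    (forall t0 t : R, oint a b t0 -> oint a b t -> t0 < t ->
       SCVDP (Phi t t0)).

(* Main.v *)
(* Along a nontrivial solution, the SCVDP of the transition matrix gives
   sc_minus (x t) <= sc_plus (x t) <= sc_minus (x s) <= sc_plus (x s) for s < t.
   Hence sc_plus strictly decreases after every time where x leaves V_c; as it
   takes even values in [0, n], this happens at most n/2 times.  The natural
   number sc_minus (x t) attains its minimum, and x stays in V_c afterwards;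
   membership in V_c excludes two adjacent zeros, since these can always be
   filled so as to create variations that are absent after deletion. *)
Require Import Defs.
From HB Require Import structures.
From mathcomp Require Import all_boot all_order all_algebra.
From mathcomp Require Import all_classical all_reals all_analysis.
From mathcomp Require Import ring lra zify.

Set Implicit Arguments.
Unset Strict Implicit.
Unset Printing Implicit Defensive.

Import Order.TTheory GRing.Theory Num.Theory.
Import numFieldNormedType.Exports.

Local Open Scope card_scope.
Local Open Scope classical_set_scope.
Local Open Scope ring_scope.

(** * Counting sign variations of a word *)

Lemma sigma_cons2 (R : realType) (a b : R) (s : seq R) :
  sigma (a :: b :: s) = ((a * b < 0)%R + sigma (b :: s))%N.
Proof.
by rewrite /sigma /= (iotaDl 1 0) count_map.
Qed.

Lemma sigma_cat_cons (R : realType) (s1 s2 : seq R) (a : R) :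
  sigma (s1 ++ a :: s2) = (sigma (rcons s1 a) + sigma (a :: s2))%N.
Proof.
elim: s1 => [|b s1 IH]; first by [].
by case: s1 IH => [|c s1] IH /=; rewrite !sigma_cons2 // IH addnA.
Qed.

Lemma sigma_rcons2 (R : realType) (a b : R) (s : seq R) :
  sigma (rcons (rcons s a) b) = (sigma (rcons s a) + (a * b < 0)%R)%N.
Proof. by rewrite -cats1 cat_rcons sigma_cat_cons sigma_cons2 addn0. Qed.

Lemma sigma_size (R : realType) (s : seq R) : (sigma s <= (size s).-1)%N.
Proof. by rewrite /sigma (leq_trans (count_size _ _)) ?size_iota. Qed.

(** Each variation flips the sign, so the parity compares the first entry with the last. *)
Lemma sigma_parity (R : realType) (a : R) (s : seq R) :
  0 \notin a :: s -> odd (sigma (a :: s)) = (a * last a s < 0).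
Proof.
elim: s a => [|b s IH] a; first by rewrite ltNge -expr2 sqr_ge0.
rewrite inE negb_or eq_sym => /andP[a0 s0].
rewrite sigma_cons2 oddD IH // oddb /=.
have b0 : b != 0 by apply: contraNneq s0 => <-; exact: mem_head.
have l0 : last b s != 0 by apply: contraNneq s0 => <-; exact: mem_last.
move: a0 b0 l0; set l := last b s.
rewrite !neq_lt => /orP[] a0 /orP[] b0 /orP[] l0;
  rewrite ?(nmulr_rlt0 _ a0) ?(pmulr_rlt0 _ a0) ?(nmulr_rlt0 _ b0)
    ?(pmulr_rlt0 _ b0) ?a0 ?b0 ?l0 ?(lt_gtF a0) ?(lt_gtF b0) ?(lt_gtF l0) //.
Qed.

(** A triangle inequality for variations: [(a * b) * (b * c)] has the sign of [a * c], so a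
    variation from [a] to [c] must show up before or after the nonzero [b]. *)
Lemma lt0_mul_trans (R : realType) (a b c : R) : b != 0 ->
  ((a * c < 0)%R <= (a * b < 0)%R + (b * c < 0)%R)%N.
Proof.
move=> b0.
have [ac|] := ltrP (a * c) 0; last by [].
have [//|ab] := ltrP (a * b) 0.
have [//|bc] := ltrP (b * c) 0.
have b2 : 0 < b ^+ 2 by rewrite exprn_even_gt0.
have : (a * b) * (b * c) < 0.
  rewrite (_ : _ * (b * c) = b ^+ 2 * (a * c)); last by ring.
  by rewrite pmulr_rlt0.
by rewrite ltNge mulr_ge0.
Qed.

(** * Fillings of zero entries by signs *)

Definition is_filling (R : realType) : seq R -> seq R -> bool :=
  all2 (fun r q => if r == 0 then (q == 1) || (q == -1) else q == r).

Lemma is_filling_nz (R : realType) (y z : seq R) :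
  is_filling y z -> 0 \notin z.
Proof.
elim: y z => [|r y IH] [|q z] //= /andP[+ /IH z0]; rewrite inE negb_or z0 andbT.
case: ifPn => [_ /orP[]|r0] /eqP->; rewrite eq_sym ?oppr_eq0 ?oner_eq0 //.
Qed.

(** Trades the tuples of bits for a relation that recurses along the two words. *)
Lemma zero_fillingsP (R : realType) (y z : seq R) :
  reflect (is_filling y z) (z \in zero_fillings y).
Proof.
apply: (iffP mapP) => [[e _ ->]|yz].
  case: e => e /= /eqP; elim: y e => [|r y IH] [|b s] //= [] /IH ->.
  rewrite andbT; case: (r == 0) => /=; last exact: eqxx.
  by case: b; rewrite ?expr1 ?expr0 eqxx ?orbT.
(* The bit of an entry records whether it is -1, since [true] stands for the exponent 1; bits at
   nonzero entries of [y] are ignored. *)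
have sz : size [seq q == -1 | q <- z] == size y.
  move: yz; rewrite /is_filling all2E => /andP[/eqP -> _].
  by rewrite size_map.
exists (Tuple sz); first by rewrite mem_enum.
rewrite /=; elim: y z yz {sz} => [|r y IH] [|q z] //= /andP[rq /IH <-].
congr (_ :: _); move: rq; case: ifP => // _ => [/orP[]|] /eqP-> //.
  by rewrite [_ == -1](_ : _ = false) // -subr_eq0 opprK -[1 + 1]/(2%:R) pnatr_eq0.
by rewrite eqxx expr1.
Qed.

Definition fill1 (R : realType) (r : R) : R := if r == 0 then 1 else r.

Lemma fill1_nz (R : realType) (r : R) : fill1 r != 0.
Proof. by rewrite /fill1; case: ifPn => //; rewrite oner_eq0. Qed.

Lemma is_filling_fill1 (R : realType) (w : seq R) :
  is_filling w [seq fill1 r | r <- w].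
Proof.
by elim: w => //= r w ->; rewrite andbT /fill1; case: (r == 0); rewrite ?eqxx.
Qed.

Lemma sigma_le_cons (R : realType) (a : R) (s : seq R) :
  (sigma s <= sigma (a :: s))%N.
Proof. by case: s => [|b s]; rewrite ?sigma_cons2 ?leq_addl. Qed.

(** By the triangle inequality, inserting a nonzero entry never loses a variation. The nonzero head
    [a] is arbitrary so that the induction can continue from an inserted 1. *)
Lemma s_minus_cons_le_sigma (R : realType) (a : R) (w : seq R) : a != 0 ->
  (s_minus (a :: w) <= sigma (a :: [seq fill1 r | r <- w]))%N.
Proof.
rewrite /s_minus /= => a0; rewrite a0.
elim: w a a0 => [|r w IH] a a0 //=.
have [r0|r0] := eqVneq r 0; rewrite /fill1 /= ?r0 ?eqxx ?(negbTE r0) sigma_cons2.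
  have n1 : (1 : R) != 0 by exact: oner_neq0.
  apply: leq_trans (leq_add (leqnn _) (IH 1 n1)).
  case: [seq r <- w | r != 0%R] => [|c l]; first by [].
  by rewrite !sigma_cons2 addnA leq_add2r lt0_mul_trans.
by rewrite sigma_cons2 leq_add2l IH.
Qed.

Lemma s_minus_le_sigma (R : realType) (w : seq R) :
  (s_minus w <= sigma [seq fill1 r | r <- w])%N.
Proof.
elim: w => [|r w IH] //=; have [->|r0] := eqVneq r 0.
  by rewrite /s_minus /= eqxx (leq_trans IH) ?sigma_le_cons.
have -> : fill1 r = r by rewrite /fill1 (negbTE r0).
exact: s_minus_cons_le_sigma.
Qed.

(** * Zeros whose filling creates additional variations *)

Lemma s_minus_cat0 (R : realType) (w1 w2 : seq R) :
  s_minus (w1 ++ 0 :: 0 :: w2) = s_minus (w1 ++ w2).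
Proof. by rewrite /s_minus !filter_cat /= eqxx. Qed.

(** Both end zeros receive the sign opposite to the last inner entry: the closing pair is then a
    variation that deletion misses. *)
Lemma endpoint_zero_gain (R : realType) (v : seq R) : v != [::] ->
  exists z, [/\ is_filling (0 :: rcons v 0) z, head 0 z = last 0 z
    & (s_minus (0%R :: rcons v 0%R) < sigma z)%N].
Proof.
case/lastP: v => [//|v a] _.
pose l := fill1 a; pose f : R := if l < 0 then 1 else -1.
have lf : l * f < 0.
  rewrite /f; case: ifPn => l0; first by rewrite mulr1.
  by rewrite mulrN1 oppr_lt0 lt_def (fill1_nz a : l != 0) leNgt.
have f1 : (f == 1) || (f == -1) by rewrite /f; case: ifP; rewrite eqxx ?orbT.
exists (f :: rcons (rcons [seq fill1 r | r <- v] l) f); split.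
- rewrite /is_filling /= eqxx f1 /= !all2E !size_rcons size_map eqxx /=.
  rewrite !zip_rcons ?size_rcons ?size_map // !all_rcons /= eqxx f1 /=.
  have := is_filling_fill1 (rcons v a).
  rewrite /is_filling all2E map_rcons => /andP[_].
  by rewrite zip_rcons ?size_map // all_rcons.
- by rewrite /= last_rcons.
- have -> : s_minus (0 :: rcons (rcons v a) 0) = s_minus (rcons v a).
    by rewrite /s_minus /= eqxx filter_rcons eqxx.
  apply: leq_trans (sigma_le_cons _ _).
  by rewrite sigma_rcons2 lf addn1 ltnS -map_rcons s_minus_le_sigma.
Qed.

(* The two zeros are filled with the sign opposite to that of the entry before
   them, then with its sign: this adds two variations. *)
Lemma double_zero_gain (R : realType) (u1 u2 : seq R) (a b : R) :
  let w := rcons u1 a ++ 0 :: 0 :: b :: u2 in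
  head 0 w = last 0 w ->
  exists z, [/\ is_filling w z, head 0 z = last 0 z & (s_minus w < sigma z)%N].
Proof.
move=> w hw; pose a' := fill1 a; pose e : R := if a' < 0 then -1 else 1.
have [ae nae ee] : [/\ a' * - e < 0, (a' * e < 0) = false & - e * e < 0].
  have a0 := fill1_nz a; rewrite -/a' in a0.
  rewrite /e; case: ifPn => l0; rewrite !(mulrN1, mulr1, opprK).
    by split=> //; rewrite oppr_lt0 lt_gtF.
  rewrite !oppr_lt0 lt_def a0 leNgt l0; split=> //.
  exact: negbTE.
have e1 : ((- e == 1) || (- e == -1)) && ((e == 1) || (e == -1)).
  by rewrite /e; case: ifP; rewrite ?opprK !eqxx ?orbT.
exists (rcons [seq fill1 r | r <- u1] a' ++ - e :: e :: [seq fill1 r | r <- b :: u2]).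
split.
- rewrite /is_filling all2E /w !size_cat /= !size_rcons !size_map eqxx /=.
  rewrite zip_cat ?size_rcons ?size_map // all_cat /= !eqxx.
  have := is_filling_fill1 (rcons u1 a); have := is_filling_fill1 (b :: u2).
  rewrite /is_filling !all2E map_rcons => /andP[_ /= ->] /andP[_ ->].
  by rewrite andbT /=; exact: e1.
- rewrite last_cat /= last_map -(_ : last 0 w = last b u2); last by rewrite last_cat.
  by rewrite -hw /w; case: (u1).
- rewrite s_minus_cat0 (leq_ltn_trans (s_minus_le_sigma _)) //.
  rewrite map_cat map_rcons /= !cat_rcons !sigma_cat_cons !sigma_cons2 ae ee.
  rewrite ltn_add2l.
  (* As [e] has the sign of [a'], any variation from [a'] to the entry after the zeros survives from
     [e] to it. *)
  have := @lt0_mul_trans _ a' e (fill1 b); rewrite nae -/a'.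
  have e0 : e != 0 by rewrite /e; case: ifP; rewrite ?oppr_eq0 oner_neq0.
  by move=> /(_ e0); lia.
Qed.

(** * Variations around the ring *)

Lemma ring_fromE (R : realType) (n : nat) (y : 'cV[R]_n) (p : 'I_n) :
  exists2 v, size v = n.-1 & ring_from y p = y p 0 :: rcons v (y p 0).
Proof.
rewrite /ring_from; set s := [seq _ | _ <- _].
have ss : size s = n by rewrite size_map size_enum_ord.
exists (drop p.+1 s ++ take p s).
  rewrite size_cat size_drop size_takel ss; last exact: ltnW.
  by have := ltn_ord p; lia.
rewrite /rot (drop_nth 0) ?ss //= (nth_map p) ?size_enum_ord //.
by rewrite nth_ord_enum.
Qed.

(** Position [n] is included: it holds the closing copy of the entry at [p]. *)
Lemma nth_ring_from (R : realType) (n : nat) (y : 'cV[R]_n) (p j : 'I_n)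
    (k : nat) :
  (k <= n)%N -> ((p + k) %% n)%N = j -> nth 0 (ring_from y p) k = y j 0.
Proof.
rewrite /ring_from; set s := [seq _ | _ <- _] => kn pk.
have ss : size s = n by rewrite size_map size_enum_ord.
have sE (i : 'I_n) : nth 0 s i = y i 0.
  by rewrite (nth_map i) ?size_enum_ord // nth_ord_enum.
have pn := ltn_ord p.
rewrite nth_rcons size_rot ss; case: ltngtP kn pk => // [kn _|-> _] pk; last first.
  by rewrite (_ : p = j) //; apply: val_inj; rewrite /= -pk modnDr modn_small.
rewrite -sE -pk /rot nth_cat size_drop ss nth_drop.
have [kp|kp] := ltnP.
  by rewrite modn_small //; lia.
rewrite nth_take; last by lia.
congr (nth _ _ _); rewrite -[(p + k)%N](subnK (_ : n <= p + k)%N); last lia.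
by rewrite modnDr modn_small; lia.
Qed.

Lemma le_sc_plus (R : realType) (n : nat) (y : 'cV[R]_n) (p : 'I_n)
    (z : seq R) :
  is_filling (ring_from y p) z -> head 0 z = last 0 z ->
  (sigma z <= sc_plus y)%N.
Proof.
move=> /zero_fillingsP zf /eqP hz; rewrite /sc_plus.
apply: leq_trans (leq_bigmax p).
exact: (leq_bigmax_seq _ zf).
Qed.

(** Filling every zero with 1 treats the two end copies alike and loses no variation. *)
Lemma sc_minus_le_plus (R : realType) (n : nat) (y : 'cV[R]_n) :
  (sc_minus y <= sc_plus y)%N.
Proof.
apply/bigmax_leqP => p _; apply: leq_trans (s_minus_le_sigma _) _.
apply: le_sc_plus (is_filling_fill1 _) _.
by have [v _ ->] := ring_fromE y p; rewrite /= map_rcons last_rcons.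
Qed.

(** An admissible filling starts and ends with the same nonzero value, so [sigma_parity] makes its
    count even. *)
Lemma sc_plus_even (R : realType) (n : nat) (y : 'cV[R]_n) :
  ~~ odd (sc_plus y).
Proof.
have em k l : ~~ odd k -> ~~ odd l -> ~~ odd (maxn k l).
  by move=> ke le; rewrite /maxn; case: ifP.
apply: (big_ind (fun k => ~~ odd k)) => // p _; rewrite big_seq_cond.
apply: (big_ind (fun k => ~~ odd k)) => // z /andP[/zero_fillingsP zf].
case: z zf => [//|c z] /is_filling_nz z0 /= /eqP hz.
by rewrite sigma_parity // -hz -expr2 ltNge sqr_ge0.
Qed.

Lemma sc_plus_le (R : realType) (n : nat) (y : 'cV[R]_n) : (sc_plus y <= n)%N.
Proof.
apply/bigmax_leqP => p _; rewrite big_seq_cond.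
apply/bigmax_leqP_seq => z _ /andP[/zero_fillingsP zf _].
apply: leq_trans (sigma_size _) _.
move: zf; rewrite /is_filling all2E => /andP[/eqP <- _].
by have [v vn ->] := ring_fromE y p; rewrite /= size_rcons vn; have := ltn_ord p; lia.
Qed.

(** Every starting point [p] gives a gain: either the ring is cut at a zero, or the two adjacent
    zeros lie strictly inside the word. *)
Lemma consecutive_zeros_gain (R : realType) (n : nat) (y : 'cV[R]_n)
    (i : 'I_n) :
  y != 0 -> y i 0 = 0 -> y (ordS i) 0 = 0 -> (sc_minus y < sc_plus y)%N.
Proof.
move=> y0 yi yi1.
(* On a ring of length 1 the single entry would vanish, against [y != 0]. *)
have n2 : (1 < n)%N.
  rewrite ltnNge; apply: contra y0 => n1; apply/eqP/matrixP => k l.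
  rewrite ord1 mxE -yi; congr (y _ _); apply: val_inj => /=.
  by have := ltn_ord k; have := ltn_ord i; lia.
suff gain p : (s_minus (ring_from y p) < sc_plus y)%N.
  (* [sc_plus y] is a successor, so the strict bounds become weak bounds by [m], which pass to the
     maximum. *)
  have := gain i; case: (sc_plus y) gain => // m gain _.
  by rewrite ltnS; apply/bigmax_leqP => p _; rewrite -ltnS gain.
have [v vn wE] := ring_fromE y p.
suff [z [zf hz zgt]] : exists z, [/\ is_filling (ring_from y p) z,
    head 0 z = last 0 z & (s_minus (ring_from y p) < sigma z)%N].
  exact: leq_trans zgt (le_sc_plus zf hz).
have [yp|yp] := eqVneq (y p 0) 0.
  by rewrite wE yp; apply: endpoint_zero_gain; rewrite -size_eq0 vn; lia.
(* The position of entry [i] when reading from [p]; adding [n - p] avoids truncated subtraction. *)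
pose k := ((i + (n - p)) %% n)%N; set w := ring_from y p.
have [pn n0] : (p < n)%N /\ (0 < n)%N by split; [exact: ltn_ord | lia].
have kn : (k < n)%N by rewrite ltn_mod.
have ki : ((p + k) %% n)%N = i.
  rewrite modnDmr addnCA subnKC; last exact: ltnW.
  by rewrite modnDr modn_small.
have wk : nth 0 w k = 0 by rewrite (@nth_ring_from _ _ y p i k) // ltnW.
have wk1 : nth 0 w k.+1 = 0.
  rewrite (@nth_ring_from _ _ y p (ordS i) k.+1) //=.
  by rewrite -addn1 addnA -modnDml ki addn1.
have sw : size w = n.+1 by rewrite /w wE /= size_rcons vn prednK.
(* Neither zero sits at an end of [w], because both ends equal the nonzero [y p 0]. *)
have k0 : k != 0%N.
  by apply: contra_neq yp => k0; rewrite -wk k0 /w wE.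
have k1 : k.+1 != n.
  apply: contra_neq yp => k1; rewrite -wk1 k1.
  by rewrite (@nth_ring_from _ _ y p p n) // modnDr modn_small.
have wD : w = take k w ++ 0 :: 0 :: drop k.+2 w.
  rewrite -[LHS](cat_take_drop k) (drop_nth 0) ?sw //; last lia.
  by rewrite wk (drop_nth 0) ?sw ?wk1 //; lia.
have hw : head 0 w = last 0 w by rewrite /w wE /= last_rcons.
have tk : take k w != [::] by rewrite -size_eq0 size_takel ?sw; lia.
have dk : drop k.+2 w != [::] by rewrite -size_eq0 size_drop sw; lia.
move: (take k w) (drop k.+2 w) tk dk wD => w1 w2 w10 w20 wD.
move: hw w10 w20; rewrite wD; case/lastP: w1 {wD} => [//|u1 a].
by case: w2 => [//|b u2] hw _ _; exact: double_zero_gain.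
Qed.

(** * Uniqueness for the linear differential system *)

(** [V] times [expR (- C * u)] is non-increasing and [V] times [expR (C * u)] is non-decreasing, so
    a zero of the nonnegative [V] travels forwards and backwards in time. *)
Lemma gronwall_zero (R : realType) (V dV : R -> R) (C c d : R) :
  c <= d ->
  (forall t, c <= t <= d -> is_derive t 1 V (dV t)) ->
  (forall t, c <= t <= d -> `|dV t| <= C * V t) ->
  (forall t, 0 <= V t) ->
  (V c = 0) <-> (V d = 0).
Proof.
move=> cd dVP dVb V0.
have dW (k t : R) : c <= t <= d ->
    is_derive t 1 (fun u => V u * expR (k * u)) ((dV t + k * V t) * expR (k * t)).
  move=> tcd; have := dVP t tcd => ?.
  apply: is_derive_eq; rewrite /GRing.scale /=; ring.
have cW (k : R) : {within `[c, d], continuous (fun u => V u * expR (k * u))}.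
  apply: derivable_within_continuous => t; rewrite in_itv /= => tcd.
  by have [] := dW k t tcd.
have sub t : t \in `]c, d[%R -> c <= t <= d.
  by rewrite in_itv /= => /andP[/ltW -> /ltW ->].
have cc : c \in `[c, d]%R by rewrite in_itv /= lexx.
have dd : d \in `[c, d]%R by rewrite in_itv /= lexx cd.
have le0 (u k : R) : V u * expR (k * u) <= 0 -> V u = 0.
  rewrite pmulr_lle0 ?expR_gt0 // => Vu.
  by apply/eqP; rewrite eq_le Vu V0.
split=> Ve.
- apply: (le0 d (- C)).
  have <- : V c * expR (- C * c) = 0 by rewrite Ve mul0r.
  apply: (@ler0_derive1_le_cc _ (fun u => V u * expR (- C * u)) c d) => //.
    by move=> t /sub tcd; have [] := dW (- C) t tcd.
  move=> t /sub tcd; rewrite derive1E; have [_ ->] := dW (- C) t tcd.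
  rewrite pmulr_lle0 ?expR_gt0 // mulNr subr_le0.
  exact: le_trans (ler_norm _) (dVb t tcd).
- apply: (le0 c C).
  have <- : V d * expR (C * d) = 0 by rewrite Ve mul0r.
  apply: (@ger0_derive1_le_cc _ (fun u => V u * expR (C * u)) c d) => //.
    by move=> t /sub tcd; have [] := dW C t tcd.
  move=> t /sub tcd; rewrite derive1E; have [_ ->] := dW C t tcd.
  rewrite pmulr_lge0 ?expR_gt0 // -lerBlDr sub0r.
  by have /ler_normlP[] := dVb t tcd; lra.
Qed.

Lemma oint_convex (R : realType) (a b : \bar R) (c d t : R) :
  oint a b c -> oint a b d -> c <= t <= d -> oint a b t.
Proof.
rewrite /oint /= => /andP[ac _] /andP[_ db] /andP[ct td].
by rewrite (lt_le_trans ac) ?lee_fin //= (le_lt_trans _ db) ?lee_fin.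
Qed.

Lemma is_derive_entry (R : realType) (m p : nat) (X : R -> 'M[R]_(m, p))
    (t : R) (D : 'M[R]_(m, p)) (i : 'I_m) (j : 'I_p) :
  is_derive t (1 : R) X D -> is_derive t (1 : R) (fun u => X u i j) (D i j).
Proof.
move=> [dX eD]; apply: DeriveDef; first exact: (derivable_mxP X t 1).1.
by rewrite -eD derive_mx // mxE.
Qed.

(** Gronwall for the squared Euclidean norm [V], with [g] the sum of the absolute values of the
    entries of [A]. *)
Lemma solves_zero (R : realType) (n : nat) (a b : \bar R) (A : R -> 'M[R]_n)
    (y : R -> 'cV[R]_n) (s t : R) :
  {within oint a b, continuous A} -> solves a b A y ->
  oint a b s -> oint a b t -> y s = 0 -> y t = 0.
Proof.
move=> hA hy.
pose V (u : R) : R := \sum_(i < n) y u i 0 ^+ 2.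
pose dV (u : R) : R := \sum_(i < n) (y u i 0 * (A u *m y u) i 0) *+ 2.
pose g (u : R) : R := \sum_(i < n) \sum_(j < n) `|A u i j|.
have V0 u : 0 <= V u by apply: sumr_ge0 => i _; exact: sqr_ge0.
have Vi u i : y u i 0 ^+ 2 <= V u.
  by rewrite /V (bigD1 i) //= lerDl sumr_ge0 // => k _; exact: sqr_ge0.
have V0E u : (V u = 0) <-> (y u = 0).
  split=> [Vu|yu]; last by rewrite /V big1 // => i _; rewrite yu mxE expr0n.
  apply/matrixP => i j; rewrite ord1 mxE; apply/eqP.
  by rewrite -sqrf_eq0 eq_le sqr_ge0 andbT -Vu.
have dVb u : `|dV u| <= 2 * g u * V u.
  rewrite /dV sumrMnl normrMn -[leLHS]mulr_natl -[leRHS]mulrA ler_wpM2l //.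
  apply: le_trans (ler_norm_sum _ _ _) _.
  rewrite /g mulr_suml; apply: ler_sum => i _.
  rewrite mxE mulr_sumr mulr_suml.
  apply: le_trans (ler_norm_sum _ _ _) _; apply: ler_sum => j _.
  rewrite mulrCA normrM ler_wpM2l // ler_norml.
  (* The two squares give [2|y_i y_j| <= y_i^2 + y_j^2 <= 2V]. *)
  have := Vi u i; have := Vi u j.
  by have := sqr_ge0 (y u i 0 + y u j 0); have := sqr_ge0 (y u i 0 - y u j 0); nra.
have dVP u : oint a b u -> is_derive u 1 V (dV u).
  move=> uab.
  have H i : is_derive u (1 : R) (fun v => y v i 0 ^+ 2)
      ((y u i 0 * (A u *m y u) i 0) *+ 2).
    have := is_derive_entry i 0 (hy u uab) => ?.
    apply: is_derive_eq; rewrite /GRing.scale /=; ring.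
  have -> : V = \sum_(i < n) (fun v => y v i 0 ^+ 2).
    by apply/funext => v; rewrite /V fct_sumE.
  exact: is_derive_sum.
have key c d : c <= d -> oint a b c -> oint a b d -> (V c = 0) <-> (V d = 0).
  move=> cd ca db.
  have sub u : c <= u <= d -> oint a b u by exact: oint_convex.
  have cA : {within `[c, d], continuous A}.
    apply: continuous_subspaceW hA => u /=; rewrite in_itv /=; exact: sub.
  have cg : {within `[c, d], continuous g}.
    move=> u; rewrite /g; apply: cvg_big => [|i _]; first exact: add_continuous.
    apply: cvg_big => [|j _]; first exact: add_continuous.
    apply: cvg_norm; apply: (@cvg_comp _ _ _ A (fun M : 'M[R]_n => M i j)).
      exact: cA.
    exact: coord_continuous.
  (* Compactness makes the rate [2 * g u] bounded by the constant [2 * g e] on [[c, d]]. *)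
  have [e _ ge] := EVT_max cd cg.
  apply: (@gronwall_zero _ V dV (2 * g e)) => // u ucd.
    exact/dVP/sub.
  apply: le_trans (dVb u) _; rewrite ler_wpM2r // ler_wpM2l //.
  by apply: ge; rewrite in_itv.
move=> sab tab /V0E Vs; apply/V0E.
by case/orP: (le_total s t) => st; apply/(key _ _ st).
Qed.

(** The difference of the two sides solves the system and vanishes at time [s], hence at every
    time. *)
Lemma solves_transition (R : realType) (n : nat) (a b : \bar R)
    (A : R -> 'M[R]_n) (Phi : R -> R -> 'M[R]_n) (x : R -> 'cV[R]_n) (s t : R) :
  {within oint a b, continuous A} -> transition_matrix a b A Phi ->
  solves a b A x -> oint a b s -> oint a b t -> x t = Phi t s *m x s.
Proof.
move=> hA hPhi hx sab tab; have [dPhi Phi1] := hPhi s sab.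
apply/eqP; rewrite -subr_eq0; apply/eqP.
apply: (@solves_zero _ _ _ _ _ (fun u => x u - Phi u s *m x s) s t hA) => //.
  move=> u uab.
  have dx i : is_derive u (1 : R) (fun v => x v i 0 - (Phi v s *m x s) i 0)
      ((A u *m (x u - Phi u s *m x s)) i 0).
    have dPx : is_derive u (1 : R) (fun v => (Phi v s *m x s) i 0)
        ((A u *m (Phi u s *m x s)) i 0).
      have -> : (fun v => (Phi v s *m x s) i 0) =
          \sum_(j < n) (fun v => x s j 0 *: Phi v s i j).
        apply/funext => v; rewrite fct_sumE mxE.
        by apply: eq_bigr => j _; exact: mulrC.
      have -> : (A u *m (Phi u s *m x s)) i 0 =
          \sum_(j < n) x s j 0 *: (A u *m Phi u s) i j.
        by rewrite mulmxA mxE; apply: eq_bigr => j _; exact: mulrC.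
      apply: is_derive_sum => j.
      by have := is_derive_entry i j (dPhi u uab) => ?; exact: is_deriveZ.
    have := is_derive_entry i 0 (hx u uab) => ?.
    by apply: is_derive_eq; rewrite mulmxBr !mxE.
  have entryE i : (fun v => (x v - Phi v s *m x s) i 0) =
      (fun v => x v i 0 - (Phi v s *m x s) i 0).
    by apply/funext => v; rewrite [LHS]mxE [X in _ + X]mxE.
  have dM : derivable (fun v => x v - Phi v s *m x s) u 1.
    by apply/derivable_mxP => i j; rewrite ord1 entryE; have [] := dx i.
  apply: DeriveDef => //; apply/matrixP => i j.
  by rewrite derive_mx // mxE ord1 entryE; have [_ ->] := dx i.
by rewrite Phi1 mul1mx subrr.
Qed.

Theorem theorem4 (R : realType) (n : nat) (a b : \bar R) (hab : (a < b)%E)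
    (A : R -> 'M[R]_n) (hA : {within oint a b, continuous A})
    (hcv : CVDDS a b A)
    (x : R -> 'cV[R]_n) (hx : solves a b A x)
    (hnt : ~ (forall t : R, oint a b t -> x t = 0)) :
  (forall s t : R, oint a b s -> oint a b t -> s <= t ->
     (sc_minus (x t) <= sc_minus (x s))%N /\
     (sc_plus (x t) <= sc_plus (x s))%N) /\
  [set t : R | oint a b t /\ ~ Vc (x t)] #<= `I_(n./2) /\
  (exists T : R, oint a b T /\
     forall tau : R, T <= tau -> (tau%:E < b)%E ->
       sc_minus (x tau) = sc_plus (x tau) /\
       forall i : 'I_n, ~ (x tau i 0 = 0 /\ x tau (ordS i) 0 = 0)).
Proof.
have [Phi [hPhi hS]] := hcv.
have x0 t : oint a b t -> x t != 0.
  move=> tab; apply/negP => /eqP xt; apply: hnt => u uab.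
  exact: (solves_zero hA hx tab uab xt).
have drop s t : oint a b s -> oint a b t -> s < t ->
    (sc_plus (x t) <= sc_minus (x s))%N.
  move=> sab tab st; rewrite (solves_transition hA hPhi hx sab tab).
  exact: hS (x0 s sab).
have pm t := sc_minus_le_plus (x t).
split; [|split].
- move=> s t sab tab; rewrite le_eqVlt => /predU1P[->|st]; first by [].
  have := drop s t sab tab st; have := pm s; have := pm t; lia.
(* At a time outside [Vc], [sc_plus] is even, positive and at most [n], so its half lies between 1
   and [n./2]; the predecessor lands in [I_(n./2)]. *)
- pose f t := (sc_plus (x t))./2.-1.
  have bad t : ~ Vc (x t) -> (sc_minus (x t) < sc_plus (x t))%N.
    by rewrite /Vc /= => /eqP nV; rewrite ltn_neqAle nV pm.
  have even t := sc_plus_even (x t).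
  apply/pcard_leP/injfunPex; exists f.
    move=> t [tab /bad tb] /=; rewrite /f.
    have := even t; have := sc_plus_le (x t); lia.
  move=> s t /set_mem[sab /bad sb] /set_mem[tab /bad tb]; rewrite /f => fst.
  have := even s; have := even t.
  (* Of two distinct exceptional times the later has the strictly smaller [sc_plus], so [f]
     separates them. *)
  have [st|ts|//] := ltgtP s t.
    by have := drop s t sab tab st; lia.
  by have := drop t s tab sab ts; lia.
(* On an empty interval the solution would count as trivial. *)
- have [t1 t1ab] : exists t, oint a b t.
    by apply: contra_notP hnt => nt t tab; case: nt; exists t.
  have [m [t0 t0ab t0m] mmin] : exists2 m, (exists2 t, oint a b t & sc_minus (x t) = m) &
      forall t, oint a b t -> (m <= sc_minus (x t))%N.
    pose P m := `[< exists2 t, oint a b t & sc_minus (x t) = m >].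
    have exP : exists m, P m by exists (sc_minus (x t1)); apply/asboolP; exists t1.
    case: (ex_minnP exP) => m /asboolP Pm mmin; exists m => // t tab.
    by apply: mmin; apply/asboolP; exists t.
  (* [T] is strictly later than the minimiser [t0], since [drop] compares distinct times only. *)
  have [T t0T Tb] : exists2 T, t0 < T & (T%:E < b)%E.
    move: t0ab; rewrite /oint /= => /andP[_].
    case: (b) => [r| |] //; last by exists (t0 + 1); rewrite ?ltrDl ?ltry.
    rewrite lte_fin => t0r; exists ((t0 + r) / 2); first by rewrite midf_lt.
    by rewrite lte_fin midf_lt.
  have ab u : t0 < u -> (u%:E < b)%E -> oint a b u.
    move=> t0u ub; move: t0ab; rewrite /oint /= => /andP[at0 _].
    by rewrite ub (lt_trans at0) // lte_fin.
  exists T; split=> [|tau Ttau taub]; first exact: ab.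
  have tauab : oint a b tau by apply: ab => //; exact: lt_le_trans Ttau.
  have E : sc_minus (x tau) = sc_plus (x tau).
    apply/eqP; rewrite eqn_leq pm /=.
    (* This closes the chain [m <= sc_minus (x tau) <= sc_plus (x tau) <= sc_minus (x t0) = m]. *)
    have := drop t0 tau t0ab tauab (lt_le_trans t0T Ttau).
    by have := mmin tau tauab; lia.
  split=> // i [xi xi1].
  by have := consecutive_zeros_gain (x0 tau tauab) xi xi1; rewrite E ltnn.
Qed.
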